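(* Let $\mathcal{H}$ be a finite family of graphs. Then there exists a constant $c_{\mathcal{H}}$ such that $\textup{cfvs}(G)/\textup{fvs}(G)\le c_{\mathcal{H}}$ for every connected $\mathcal{H}$-free graph $G$ (i.e. the price of connectivity for feedback vertex set for the class of $\mathcal{H}$-free graphs is upper bounded by a constant) if and only if $\mathcal{H}$ covers the pair $(i,j)$ for every pair of integers $i,j\ge 3$.
   Context: All graphs are finite and simple. A feedback vertex set of a graph $G$ is a set $S\subseteq V(G)$ such that $G-S$ is a forest; it is connected if $G[S]$ is connected. $\textup{fvs}(G)$ and $\textup{cfvs}(G)$ denote the minimum size of a feedback vertex set and of a connected feedback vertex set of $G$. The price of connectivity for feedback vertex set for a class $\mathcal{G}$ is the maximum (supremum) of $\textup{cfvs}(G)/\textup{fvs}(G)$ over connected graphs $G\in\mathcal{G}$. A graph is $\mathcal{H}$-free if it has no induced subgraph isomorphic to a member of $\mathcal{H}$. For $i,j\ge 3$, $k\ge1$, the butterfly $B_{i,j,k}$ is obtained from the disjoint union of cycles $C_i$ and $C_j$ by choosing a vertex $x$ of $C_i$ and a vertex $y$ of $C_j$ and adding a path of length $k$ (i.e. with $k$ edges) between $x$ and $y$. For a finite family $\mathcal{H}$ and integers $i,j\ge3$, let $N=2\cdot\max_{H\in\mathcal{H}}|V(H)|+1$; $\mathcal{H}$ covers $(i,j)$ if $\mathcal{H}$ contains a graph isomorphic to an induced subgraph of $B_{i,j,N}$. *)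

(* Defs.v *)
From HB Require Import structures.
From mathcomp Require Import all_boot all_order all_algebra.
From mathcomp Require Import boolp reals.

Set Implicit Arguments.
Unset Strict Implicit.
Unset Printing Implicit Defensive.

Record sgraph := SGraph {
  vertex :> finType;
  edge : rel vertex;
  edge_sym : symmetric edge;
  edge_irr : irreflexive edge }.

Section InducedSubgraph.
Variables (G : sgraph) (S : {set G}).

Definition induced_edge : rel {x : G | x \in S} :=
  fun u v => edge (val u) (val v).

Lemma induced_edge_sym : symmetric induced_edge.
Proof. by move=> u v; apply: edge_sym. Qed.

Lemma induced_edge_irr : irreflexive induced_edge.
Proof. by move=> u; apply: edge_irr. Qed.

Definition induced : sgraph := SGraph induced_edge_sym induced_edge_irr.
End InducedSubgraph.

Definition isomorphic (G H : sgraph) : Prop :=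
  exists2 f : G -> H, bijective f & forall x y, edge (f x) (f y) = edge x y.

Definition is_induced_subgraph (H G : sgraph) : Prop :=
  exists S : {set G}, isomorphic H (induced S).

(* The graph without vertices counts as connected, so the empty set is a
   connected feedback vertex set of every forest. *)
Definition connected (G : sgraph) : Prop :=
  forall x y : G, connect (@edge G) x y.

(* [ucycle] also accepts sequences of length at most 2, which are not cycles
   of a simple graph. *)
Definition forest (G : sgraph) : Prop :=
  forall c : seq G, 2 < size c -> ~ ucycle (@edge G) c.

Definition is_fvs (G : sgraph) (S : {set G}) : Prop := forest (induced (~: S)).

Definition is_cfvs (G : sgraph) (S : {set G}) : Prop :=
  is_fvs S /\ connected (induced S).

Definition fvs (G : sgraph) : nat :=
  #|[arg min_(S < [set: G] | `[< is_fvs S >]) #|S|]|.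

(* The default [set: G] is itself a connected feedback vertex set when [G] is
   connected, the only case in which [cfvs G] is used. *)
Definition cfvs (G : sgraph) : nat :=
  #|[arg min_(S < [set: G] | `[< is_cfvs S >]) #|S|]|.

Definition free_of (I : finType) (F : I -> sgraph) (G : sgraph) : Prop :=
  forall h : I, ~ is_induced_subgraph (F h) G.

Section Butterfly.
Variables i j k : nat.

(* The two cycles, and the k - 1 inner vertices of the path joining them. *)
Definition butterfly_vertex : finType := ('I_i + 'I_j + 'I_k.-1)%type.

(* Position along the path, which runs from vertex 0 of the first cycle
   (position 0) to vertex 0 of the second cycle (position k). *)
Definition path_pos (u : butterfly_vertex) : option nat :=
  match u with
  | inl (inl a) => if val a == 0 then Some 0 else None
  | inl (inr b) => if val b == 0 then Some k else None
  | inr p => Some (val p).+1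
  end.

Definition butterfly_arc (u v : butterfly_vertex) : bool :=
  match u, v with
  | inl (inl a), inl (inl a') => a' == ordS a
  | inl (inr b), inl (inr b') => b' == ordS b
  | _, _ => if (path_pos u, path_pos v) is (Some p, Some q)
            then q == p.+1 else false
  end.

(* [u != v] matters only in the degenerate case of a one-vertex cycle. *)
Definition butterfly_edge : rel butterfly_vertex :=
  fun u v => (u != v) && (butterfly_arc u v || butterfly_arc v u).

Lemma butterfly_edge_sym : symmetric butterfly_edge.
Proof. by move=> u v; rewrite /butterfly_edge eq_sym orbC. Qed.

Lemma butterfly_edge_irr : irreflexive butterfly_edge.
Proof. by move=> u; rewrite /butterfly_edge eqxx. Qed.

(* Meaningful for i, j >= 3 and k >= 1. *)
Definition butterfly : sgraph := SGraph butterfly_edge_sym butterfly_edge_irr.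
End Butterfly.

Definition covering_length (I : finType) (F : I -> sgraph) : nat :=
  2 * (\max_(h : I) #|F h|) + 1.

Definition covers (I : finType) (F : I -> sgraph) (i j : nat) : Prop :=
  exists h : I,
    is_induced_subgraph (F h) (butterfly i j (covering_length F)).

(* Main.v *)
Require Import Defs.
From HB Require Import structures.
From mathcomp Require Import all_boot all_order all_algebra.
From mathcomp Require Import boolp reals.
From mathcomp Require Import zify.
Set Implicit Arguments.
Unset Strict Implicit.
Unset Printing Implicit Defensive.
Import Order.TTheory GRing.Theory Num.Theory.

(* Let [m] be the largest order of a member of the family and [N = 2m + 1].

   If the pair [(i, j)] is not covered, then for every [k >= N] the butterfly
   [B_{i,j,k}] is free of the family: an induced copy of a graph of order at
   most [m] misses two consecutive vertices of the long path, where the path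
   can be shortened.  These butterflies have bounded [fvs], while a connected
   feedback vertex set has to contain the path.

   Conversely, call a vertex branching if infinite non-backtracking walks leave
   it through three different neighbours.  Two branching vertices that are far
   apart yield a member of the family: around each of them there is either a
   short cycle or, the ball being a tree, three long legs, and the latter
   realise any [m] vertices of the cycle [C_{m+3}] of a butterfly.  Hence all branching
   vertices lie within a constant distance [D] of one of them, [a], which exists
   as soon as [fvs >= 2].  A cycle through [v <> a] that avoids the neighbour of
   [v] closer to [a] makes [v] branching, so the vertices of a feedback vertex
   set can be pushed towards [a] until they are within distance [D], and then be
   joined to [a] by shortest paths. *)

(** * Distances *)

Section Dist.
Variable G : sgraph.
Implicit Types (x y z : G) (n k : nat).

Fixpoint ball x n : {set G} :=
  if n is m.+1 then ball x m :|: [set y | [exists z in ball x m, edge z y]]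
  else [set x].

Lemma ball0 x n : x \in ball x n.
Proof. by elim: n => [|n IH] /=; rewrite !inE ?IH. Qed.

Lemma ballS x n y :
  reflect (y \in ball x n \/ exists2 z, z \in ball x n & edge z y)
          (y \in ball x n.+1).
Proof.
rewrite /= !inE; apply: (iffP orP) => -[H|H]; first by left.
- by right; case/existsP: H => z /andP[]; exists z.
- by left.
by right; case: H => z Hz e; apply/existsP; exists z; rewrite Hz.
Qed.

Lemma ball_edge x y : edge x y -> y \in ball x 1.
Proof. by move=> e; apply/ballS; right; exists x => //; apply: ball0. Qed.

Lemma ball_trans x y z n m :
  y \in ball x n -> z \in ball y m -> z \in ball x (n + m).
Proof.
move=> Hy; elim: m z => [|m IH] z.
  by rewrite addn0 /= inE => /eqP->.
rewrite addnS => /ballS[/IH H|[t /IH Ht e]]; apply/ballS; first by left.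
by right; exists t.
Qed.

Lemma ball_sym x y n : y \in ball x n -> x \in ball y n.
Proof.
elim: n y => [|n IH] y; first by rewrite /= !inE eq_sym.
case/ballS => [/IH H|[z /IH Hz e]]; first by apply/ballS; left.
by rewrite -add1n; apply: ball_trans Hz; apply: ball_edge; rewrite edge_sym.
Qed.

(* Junk value: [dist x y = 0] when [y] cannot be reached from [x]. *)
Definition dist x y : nat :=
  if pselect (exists n, y \in ball x n) is left H then ex_minn H else 0.

Lemma connect_ball x y : connect (@edge G) x y -> exists n, y \in ball x n.
Proof.
case/connectP => p; elim: p x => [|z p IH] x /=.
  by move=> _ ->; exists 0; rewrite inE.
case/andP=> e Hp /IH -/(_ Hp)[n Hn]; exists (1 + n).
by apply: ball_trans Hn; apply: ball_edge.
Qed.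

Hypothesis conG : connected G.

Lemma dist_le x y n : (dist x y <= n) = (y \in ball x n).
Proof.
rewrite /dist; case: pselect => [H|H]; last first.
  by case: H; apply: connect_ball.
case: ex_minnP => m Hm min; apply/idP/idP => [le_mn|/min//].
by rewrite -(subnKC le_mn); apply: ball_trans Hm (ball0 _ _).
Qed.

Lemma dist_sym x y : dist x y = dist y x.
Proof.
have le a b: dist a b <= dist b a by rewrite dist_le ball_sym // -dist_le.
by apply/eqP; rewrite eqn_leq !le.
Qed.

Lemma dist_trans y x z : dist x z <= dist x y + dist y z.
Proof. by rewrite dist_le; apply: (@ball_trans _ y); rewrite -dist_le. Qed.

Lemma dist_eq0 x y : (dist x y == 0) = (x == y).
Proof. by rewrite -leqn0 dist_le /= inE eq_sym. Qed.

Lemma distxx x : dist x x = 0.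
Proof. by apply/eqP; rewrite dist_eq0. Qed.

Lemma edge_dist x y : edge x y = (dist x y == 1).
Proof.
apply/idP/eqP => [e|d1].
  have ne: x != y by apply: contraL e => /eqP->; rewrite edge_irr.
  have: dist x y <= 1 by rewrite dist_le ball_edge.
  by move: ne; rewrite -dist_eq0; case: (dist x y) => [|[]].
have: y \in ball x 1 by rewrite -dist_le d1.
case/ballS => [|[z]]; rewrite /= inE => /eqP E; last by rewrite E.
by move: d1; rewrite E distxx.
Qed.

Lemma dist_parent x y n :
  dist x y = n.+1 -> exists2 u, edge y u & dist x u = n.
Proof.
move=> d; have: y \in ball x n.+1 by rewrite -dist_le d.
case/ballS => [|[u]]; first by rewrite -dist_le d ltnn.
rewrite -dist_le => Hu e; exists u; first by rewrite edge_sym.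
have := dist_trans u x y; have := e; rewrite edge_dist d => /eqP->; lia.
Qed.

(** Following parents back from [y] gives a path with adjacent consecutive vertices. The triangle
    inequality bounds distances along it from above, and a strict inequality anywhere would make
    [dist x y] too small. *)
Lemma geodesic x y :
  exists p : nat -> G, [/\ p 0 = x, p (dist x y) = y &
    forall s t, s <= t -> t <= dist x y -> dist (p s) (p t) = t - s].
Proof.
have [p [p0 pd ep]]: exists p : nat -> G, [/\ p 0 = x, p (dist x y) = y &
    forall s, s < dist x y -> edge (p s) (p s.+1)].
  move E: (dist x y) => n; move: E.
  elim: n y => [|n IH] y d.
    by exists (fun=> y); move/eqP: d; rewrite dist_eq0 => /eqP->.
  have [u e /IH[p [p0 pn ep]]] := dist_parent d.
  exists (fun s => if s <= n then p s else y); split=> //; first by rewrite ltnn.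
  move=> s; rewrite ltnS; case: (ltngtP s n) => // [lt_sn|->] _; first exact: ep.
  by rewrite pn edge_sym.
exists p; split=> //.
have ub s t: s <= t -> t <= dist x y -> dist (p s) (p t) <= t - s.
  move=> le_st; rewrite -(subnKC le_st) addKn.
  elim: (t - s) => [|r IH] H; first by rewrite addn0 distxx.
  have {}IH: dist (p s) (p (s + r)) <= r by apply: IH; lia.
  have: edge (p (s + r)) (p (s + r.+1)) by rewrite addnS; apply: ep; lia.
  by rewrite edge_dist => /eqP E; have := dist_trans (p (s + r)) (p s) (p (s + r.+1)); lia.
move=> s t le_st le_td; apply/eqP; rewrite eqn_leq ub //=.
have := ub 0 s (leq0n _) (leq_trans le_st le_td); have := ub t _ le_td (leqnn _).
rewrite p0 pd.
have := dist_trans (p s) x y; have := dist_trans (p t) (p s) y; lia.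
Qed.

End Dist.

(** * Cycles as functions on an initial segment of the natural numbers *)

Section Cycles.
Variable G : sgraph.
Implicit Types (c : nat -> G) (X S : {set G}).

Record cycle_fun n (c : nat -> G) : Prop := CycleFun {
  cyc_size : 2 < n;
  cyc_step : forall s, s.+1 < n -> edge (c s) (c s.+1);
  cyc_close : edge (c n.-1) (c 0);
  cyc_inj : forall s t, s < n -> t < n -> c s = c t -> s = t }.

Lemma edge_neq (x y : G) : edge x y -> x != y.
Proof. by apply: contraL => /eqP->; rewrite edge_irr. Qed.

Lemma cycle_fun_ucycle n c :
  cycle_fun n c -> ucycle (@edge G) (mkseq c n).
Proof.
case=> n2 st cl inj; rewrite /ucycle; apply/andP; split; last first.
  apply/(uniqP (c 0)) => s t; rewrite !inE size_mkseq => sn tn.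
  by rewrite !nth_mkseq //; apply: inj.
case: n n2 st cl {inj} => // n n2 st cl.
have lastE: last 0 (iota 1 n) = n.
  by rewrite (last_nth 0) size_iota -[0 :: _]/(iota 0 n.+1) nth_iota.
rewrite (cycle_path (c 0)) /= last_map lastE cl /=.
apply/(pathP (c 0)) => s; rewrite size_map size_iota => sn.
rewrite (nth_map 0) ?size_iota // nth_iota //.
case: s sn => [|s] sn /=; first by apply: st; lia.
rewrite (nth_map 0) ?size_iota ?nth_iota; try lia.
by apply: st; lia.
Qed.

Lemma ucycle_cycle_fun (x0 : G) (l : seq G) :
  2 < size l -> ucycle (@edge G) l -> cycle_fun (size l) (nth x0 l).
Proof.
move=> l2 /andP[cl ul]; split=> //; last first.
- by move=> s t sl tl /eqP; rewrite nth_uniq // => /eqP.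
- case: l l2 cl {ul} => // a l l2; rewrite (cycle_path x0) => /andP[+ _].
  by rewrite -nth_last.
case: l l2 cl {ul} => // a l l2 /=; rewrite rcons_path => /andP[/(pathP x0) H _].
by move=> s; apply: H.
Qed.

End Cycles.

Section CyclesTheory.
Variable G : sgraph.
Implicit Types (c : nat -> G) (X S : {set G}).

Definition acyclic X :=
  forall n c, cycle_fun n c -> exists2 s, s < n & c s \notin X.

Lemma forest_inducedP X : forest (induced X) <-> acyclic X.
Proof.
split=> [fX n c cc|H l l2 ul].
  apply: contrapT => H; have inX s: s < n -> c s \in X.
    by move=> sn; apply: contrapT => /negP nX; apply: H; exists s.
  have n0: 0 < n by have := cyc_size cc; lia.
  (* Beyond [n] the values of [c] may leave [X]; there [insubd] falls back on [c 0]. *)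
  pose c' s : induced X := insubd (Sub (c 0) (inX 0 n0)) (c s).
  have cE s: s < n -> val (c' s) = c s by move=> sn; rewrite val_insubd inX.
  suff: cycle_fun n c'.
    by move/cycle_fun_ucycle; apply: fX; rewrite size_mkseq (cyc_size cc).
  case: (cc) => n2 st cl inj; split=> //.
  - by move=> s sn; rewrite /= /induced_edge !cE ?st //; lia.
  - by rewrite /= /induced_edge !cE ?cl //; lia.
  by move=> s t sn tn /(congr1 val); rewrite !cE //; apply: inj.
have [x0 _]: exists x0 : induced X, True by case: (l) l2 => // x0 ? _; exists x0.
have cl := ucycle_cycle_fun x0 l2 ul.
have cv: cycle_fun (size l) (fun s => val (nth x0 l s)).
  case: cl => n2 st cl inj; split=> //.
  by move=> s t sn tn /val_inj; apply: inj.
by have [s _] := H _ _ cv; rewrite (valP (nth x0 l s)).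
Qed.

Lemma is_fvsP S :
  is_fvs S <-> (forall n c, cycle_fun n c -> exists2 s, s < n & c s \in S).
Proof.
rewrite /is_fvs forest_inducedP.
by split=> H n c cc; have [s sn Hs] := H n c cc; exists s => //; move: Hs; rewrite inE negbK.
Qed.

Lemma cycle_rot n c r : cycle_fun n c -> r < n ->
  exists c', [/\ cycle_fun n c', c' 0 = c r &
    (forall s, s < n -> exists2 t, t < n & c' s = c t)].
Proof.
case=> n2 st cl inj rn.
exists (fun s => if s + r < n then c (s + r) else c (s + r - n)); split.
- split=> //.
  + move=> s sn; case: ifP => H1; case: ifP => H2; try lia.
    * by rewrite addSn; apply: st; lia.
    * have ->: s + r = n.-1 by lia.
      by have ->: s.+1 + r - n = 0 by lia.
    * have ->: s.+1 + r - n = (s + r - n).+1 by lia.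
      by apply: st; lia.
  + case: ifP => H1; case: ifP => H2; try lia.
    * have r0: r = 0 by lia.
      by rewrite r0 !addn0.
    * have -> /=: 0 + r = (n.-1 + r - n).+1 by lia.
      by apply: st; lia.
  + move=> s t sn tn; case: ifP => H1; case: ifP => H2 /inj; lia.
- by rewrite add0n rn.
move=> s sn; case: ifP => H; first by exists (s + r).
by exists (s + r - n) => //; lia.
Qed.

(** Lets facts about the neighbour [c 1] of the base point carry over to its other neighbour
    [c n.-1]. *)
Lemma cycle_rev n c : cycle_fun n c ->
  exists c', [/\ cycle_fun n c', c' 0 = c 0, c' 1 = c n.-1 &
    (forall s, s < n -> exists2 t, t < n & c' s = c t)].
Proof.
case=> n2 st cl inj.
exists (fun s => if s is s'.+1 then c (n - s) else c 0); split=> //.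
- split=> //.
  + case=> [|s] sn; first by rewrite subn1 edge_sym.
    have E: n - s.+1 = (n - s.+2).+1 by lia.
    by rewrite E edge_sym; apply: st; lia.
  + case: n n2 st {cl inj} => [|[|n]] // n2 st; rewrite /= edge_sym.
    have ->: n.+2 - n.+1 = 1 by lia.
    by apply: st.
  + by move=> [|s] [|t] sn tn /inj; lia.
- by rewrite subn1.
case=> [|s] sn; first by exists 0.
by exists (n - s.+1) => //; lia.
Qed.

End CyclesTheory.

Section ChordlessCycles.
Variable G : sgraph.
Implicit Types (c : nat -> G) (X : {set G}).

Definition chordless n c :=
  forall s t, s < t -> t < n -> edge (c s) (c t) ->
    t = s.+1 \/ s = 0 /\ t = n.-1.

(* A shortest cycle through a given vertex has no chord, since the chord would
   cut off a shorter cycle through that vertex. *)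
Lemma chordless_cycle X n c :
  cycle_fun n c -> (forall s, s < n -> c s \in X) ->
  exists n' c', [/\ cycle_fun n' c', c' 0 = c 0,
    (forall s, s < n' -> c' s \in X) & chordless n' c'].
Proof.
elim/ltn_ind: n c => n IH c cc inX.
case: (pselect (chordless n c)) => [|nch]; first by exists n, c.
have [s [t [st tn e ns n0]]] : exists s t, [/\ s < t, t < n, edge (c s) (c t),
    t <> s.+1 & ~ (s = 0 /\ t = n.-1)].
  apply: contrapT => H; apply: nch => s t st tn e; apply: contrapT => nst.
  by apply: H; exists s, t; split=> // H; apply: nst; [left | right].
have [n2 stp cl inj] := cc.
(* The chord replaces the stretch strictly between [s] and [t]; index 0 survives, so the base point
   is kept. *)
pose c' e := if e <= s then c e else c (e + (t - s.+1)).
have [|||n' [c'' [H1 H2 H3 H4]]] := IH (n - (t - s.+1)) _ c'; try lia.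
- split; try lia.
  + move=> r rn; rewrite /c'; case: ifP => r1; case: ifP => r2; try lia.
    * by apply: stp; lia.
    * have -> : r = s by lia.
      by have ->: s.+1 + (t - s.+1) = t by lia.
    * by apply: stp; lia.
  + rewrite /c' leq0n; case: ifP => H; first lia.
    by have ->: (n - (t - s.+1)).-1 + (t - s.+1) = n.-1 by lia.
  + by move=> a b an bn; rewrite /c'; case: ifP => a1; case: ifP => b1 /inj; lia.
- by move=> r rn; rewrite /c'; case: ifP => ?; apply: inX; lia.
by exists n', c''.
Qed.

End ChordlessCycles.

(** * Non-backtracking walks *)

Section NonBacktracking.
Variable G : sgraph.
Implicit Types (a x y z : G) (c w : nat -> G) (X : {set G}).

Definition nb_walk n w :=
  (forall s, s < n -> edge (w s) (w s.+1)) /\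
  (forall s, s.+1 < n -> w s <> w s.+2).

(** Induction on [t - s]: the stretch in between is already injective, so a coincidence would close
    a cycle of length [t - s], and a chord one of length [t - s + 1]. Coincidences at gaps 1 and 2
    are excluded by irreflexivity and non-backtracking. *)
Lemma nb_walk_acyclic X n w : acyclic X -> nb_walk n w ->
  (forall s, s <= n -> w s \in X) ->
  forall s t, s < t -> t <= n -> w s <> w t /\ edge (w s) (w t) = (t == s.+1).
Proof.
move=> acX [ew nw] inX.
suff H d s : 0 < d -> s + d <= n ->
    w s <> w (s + d) /\ edge (w s) (w (s + d)) = (d == 1).
  move=> s t st tn; have [||] := H (t - s) s; try lia.
  by rewrite subnKC ?(ltnW st) // => ? ->; split=> //; lia.
elim/ltn_ind: d s => d IH s d0 sd.
have IH1 i j : i < j -> j <= d -> ~ (i = 0 /\ j = d) -> w (s + i) <> w (s + j).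
  move=> ij jd nij; have [|||+ _] := IH (j - i) _ (s + i); try lia.
  by have ->: s + i + (j - i) = s + j by lia.
have nocyc m : m <= d.+1 -> cycle_fun m (fun e => w (s + e)) -> False.
  by move=> md cc; have [e em] := acX _ _ cc; rewrite inX //; lia.
have neq : w s <> w (s + d).
  move=> E; have [d1|[d2|d3]] : d = 1 \/ d = 2 \/ 2 < d by lia.
  - have /edge_neq := ew s ltac:(lia).
    by rewrite E d1 addn1 eqxx.
  - by apply: (nw s); [lia | rewrite E d2 addn2].
  apply: (nocyc d) => //; split=> //.
  - by move=> e ed; rewrite addnS; apply: ew; lia.
  - rewrite addn0 E; have ->: s + d = (s + d.-1).+1 by lia.
    by apply: ew; lia.
  - move=> a b ad bd; case: (ltngtP a b) => // ab; first by move/IH1; lia.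
    by move/esym/IH1; lia.
split=> //; apply/idP/eqP => [e|d1]; last by rewrite d1 addn1 ew; lia.
apply: contrapT => d1; apply: (nocyc d.+1) => //; split; first lia.
- by move=> r rd; rewrite addnS; apply: ew; lia.
- by rewrite /= addn0 edge_sym.
move=> a b ad bd; case: (ltngtP a b) => // ab.
  have [[-> ->]|] := pselect (a = 0 /\ b = d); first by rewrite addn0.
  by move=> nab /IH1; lia.
have [[-> ->]|] := pselect (b = 0 /\ a = d); first by rewrite addn0 => /esym.
by move=> nab /esym/IH1; lia.
Qed.

Lemma nb_walks_acyclic X n w n' w' :
  acyclic X -> nb_walk n w -> nb_walk n' w' ->
  (forall s, s <= n -> w s \in X) -> (forall s, s <= n' -> w' s \in X) ->
  w 0 = w' 0 -> w 1 <> w' 1 ->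
  forall s t, s <= n -> t <= n' ->
    (w s = w' t -> s = 0 /\ t = 0) /\ edge (w s) (w' t) = (s + t == 1).
Proof.
move=> acX [e1 n1] [e2 n2] i1 i2 E0 N1 s t sn tn.
have [/andP[/eqP-> /eqP->]|st0] := boolP ((s == 0) && (t == 0)).
  by rewrite E0 edge_irr.
(* [w] reversed, followed by [w']: at the joint there is no backtracking because [w 1 <> w' 1]. *)
pose z e := if e <= n then w (n - e) else w' (e - n).
have nbz : nb_walk (n + n') z.
  split=> r rn; rewrite /z.
  - case: ifP => r1; case: ifP => r2; try lia.
    + have ->: n - r = (n - r.+1).+1 by lia.
      by rewrite edge_sym; apply: e1; lia.
    + have ->: n - r = 0 by lia.
      have ->: r.+1 - n = 1 by lia.
      by rewrite E0; apply: e2; lia.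
    + have ->: r.+1 - n = (r - n).+1 by lia.
      by apply: e2; lia.
  case: ifP => r1; case: ifP => r2; try lia.
  - have ->: n - r = (n - r.+2).+2 by lia.
    by apply/nesym/n1; lia.
  - have [rE|rn1] : r = n \/ r.+1 = n by lia.
    + rewrite rE in rn *; have ->: n.+2 - n = 2 by lia.
      by rewrite subnn E0; apply: n2; lia.
    have ->: n - r = 1 by lia.
    by have ->: r.+2 - n = 1 by lia.
  have ->: r.+2 - n = (r - n).+2 by lia.
  by apply: n2; lia.
have inz r : r <= n + n' -> z r \in X.
  by move=> rn; rewrite /z; case: ifP => H; [apply: i1 | apply: i2]; lia.
have [||] := nb_walk_acyclic acX nbz inz (s := n - s) (t := n + t); try lia.
have ->: z (n - s) = w s.
  by rewrite /z leq_subr; have ->: n - (n - s) = s by lia.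
have ->: z (n + t) = w' t.
  rewrite /z; case: ifP => H; last by rewrite addKn.
  have ->: t = 0 by lia.
  by rewrite addn0 subnn.
by move=> ne ->; split=> //; lia.
Qed.

Definition ray x y :=
  exists w, [/\ w 0 = x, w 1 = y & forall n, nb_walk n w].

(** Three rays through distinct neighbours, in a form that supplies a further direction once two are
    forbidden. *)
Definition branching a :=
  forall u v, exists2 x, ray a x & x <> u /\ x <> v.

Lemma branching_of a x y z :
  ray a x -> ray a y -> ray a z -> x <> y -> x <> z -> y <> z -> branching a.
Proof.
move=> ax ay az xy xz yz u v.
case: (eqVneq x u) => [<-|/eqP xu].
  case: (eqVneq y v) => [<-|/eqP yv]; first by exists z => //; split; apply/nesym.
  by exists y => //; split=> //; apply/nesym.
case: (eqVneq x v) => [<-|/eqP xv]; last by exists x.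
case: (eqVneq y u) => [<-|/eqP yu]; first by exists z => //; split; apply/nesym.
by exists y => //; split=> //; apply/nesym.
Qed.

Lemma ray_cons x y z : edge x y -> ray y z -> z <> x -> ray x y.
Proof.
move=> e [w [w0 w1 nb]] zx.
exists (fun s => if s is s'.+1 then w s' else x); split=> // n.
split=> -[|s] sn //=; first by rewrite w0.
- by case: (nb s.+1) => + _; apply.
- by rewrite w1; apply/nesym.
by case: (nb s.+2) => _; apply.
Qed.

Lemma cycle_ray n c : cycle_fun n c -> ray (c 0) (c 1).
Proof.
case=> n2 st cl inj; exists (fun s => c (s %% n)).
have n0 : 0 < n by lia.
have mS s : (s %% n).+1 < n /\ s.+1 %% n = (s %% n).+1 \/
            s %% n = n.-1 /\ s.+1 %% n = 0.
  have lt := ltn_pmod s n0.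
  have -> : s.+1 %% n = (s %% n).+1 %% n by rewrite -(addn1 s) -modnDml addn1.
  case: (ltnP (s %% n).+1 n) => H; first by left; rewrite modn_small.
  have E : (s %% n).+1 = n by lia.
  by right; rewrite E modnn -{2}E.
split=> [||k]; rewrite ?mod0n // ?modn_small //; first lia.
split=> s _; first by have [[lt ->]|[-> ->]] := mS s; [apply: st|].
move/inj => -/(_ (ltn_pmod _ n0) (ltn_pmod _ n0)).
by have := mS s; have := mS s.+1; lia.
Qed.

Lemma cycle_rays n c :
  cycle_fun n c -> [/\ ray (c 0) (c 1), ray (c 0) (c n.-1) & c 1 <> c n.-1].
Proof.
move=> cc; have [c' [cc' E0 E1 _]] := cycle_rev cc.
split; [exact: cycle_ray cc | by rewrite -E0 -E1; apply: cycle_ray cc' |].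
by case: cc => n2 _ _ inj /inj; lia.
Qed.

Hypothesis conG : connected G.

(* Walk from the second cycle back to the first one and then around it. *)
Lemma two_cycles_branching n c n' c' :
  cycle_fun n c -> cycle_fun n' c' -> (forall s, s < n' -> c' s <> c 0) ->
  exists a, branching a.
Proof.
move=> cc cc' av.
have n'0 : 0 < n' by have := cyc_size cc'; lia.
pose i0 := Ordinal n'0.
have [i _ imin] := arg_minnP (P := predT) (fun i : 'I_n' => dist (c 0) (c' i)) (erefl : predT i0).
have [c2 [cc2 c20 c2c']] := cycle_rot cc' (ltn_ord i).
have {}imin s : s < n' -> dist (c 0) (c' i) <= dist (c 0) (c2 s).
  by move=> /c2c'[t tn ->]; apply: (imin (Ordinal tn)).
rewrite -c20 in imin; have [p [p0 pk dp]] := geodesic conG (c 0) (c2 0).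
have k0 : 0 < dist (c 0) (c2 0).
  by rewrite lt0n (dist_eq0 conG) eq_sym c20; apply/eqP/av.
set k := dist _ _ in imin pk dp k0.
(* The walk follows the geodesic back to [c 0] and enters the first cycle by a neighbour other than
   [p 1], so it never turns back. *)
have rayp s : s < k -> ray (p s.+1) (p s).
  elim: s => [|s IH] sk.
    have e : edge (p 1) (p 0) by rewrite edge_sym (edge_dist conG) dp.
    have [r1 r2 ne] := cycle_rays cc.
    rewrite p0 in e *; have [E|/eqP ne1] := eqVneq (c 1) (p 1).
      by apply: ray_cons e r2 _; rewrite -E; apply/nesym.
    exact: ray_cons e r1 ne1.
  apply: ray_cons (IH (ltnW sk)) _; first by rewrite edge_sym (edge_dist conG) dp //; lia.
  move=> E; have := dp s s.+2; rewrite E (distxx conG); lia.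
have [r1 r2 ne] := cycle_rays cc2.
have r3 : ray (c2 0) (p k.-1).
  by have := rayp k.-1; rewrite prednK // pk; apply; lia.
(* [p k.-1] is closer to [c 0] than every vertex of the second cycle, hence differs from both cycle
   neighbours of [c2 0]. *)
exists (c2 0); apply: branching_of r1 r2 r3 ne _ _.
- move=> E; have := imin 1; rewrite E.
  have := dp 0 k.-1; rewrite p0; have := cyc_size cc2; lia.
- move=> E; have := imin n'.-1; rewrite E.
  have := dp 0 k.-1; rewrite p0; have := cyc_size cc2; lia.
Qed.

(** The walk descends to [a], and branching lets it leave [a] by a neighbour other than the one it
    came from. *)
Lemma ray_toward a v u k : branching a ->
  dist a v = k.+1 -> edge v u -> dist a u = k -> ray v u.
Proof.
move=> ba; elim: k v u => [|k IH] v u dv e du.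
  move/eqP: du; rewrite (dist_eq0 conG) => /eqP E; rewrite -E in e *.
  by have [x rx [xv _]] := ba v v; apply: ray_cons e rx xv.
have [x ux dx] := dist_parent conG du.
apply: ray_cons e (IH _ _ du ux dx) _ => E.
by move: dx; rewrite E dv; lia.
Qed.

(** Two rays go around the cycle in opposite directions, the third one through [u] towards [a]. *)
Lemma cycle_avoiding_parent_branching a u k n c : branching a ->
  cycle_fun n c -> dist a (c 0) = k.+1 -> edge (c 0) u -> dist a u = k ->
  (forall s, s < n -> c s <> u) -> branching (c 0).
Proof.
move=> ba cc dv e du av; have [r1 r2 ne] := cycle_rays cc.
by apply: branching_of r1 r2 (ray_toward ba dv e du) ne _ _;
  apply: av; have := cyc_size cc; lia.
Qed.

End NonBacktracking.

(** * Induced subgraphs as embeddings *)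

Lemma is_induced_subgraphP (H G : sgraph) :
  is_induced_subgraph H G <->
  exists f : H -> G, injective f /\ forall x y, edge (f x) (f y) = edge x y.
Proof.
split=> [[S [f bf ef]]|[f [injf ef]]].
  exists (fun x => val (f x)); split=> [x y /val_inj|x y].
    exact: bij_inj.
  by rewrite -ef.
have fS x : f x \in [set f y | y in H] by apply: imset_f.
exists [set f y | y in H].
have bij : bijective (fun x => Sub (f x) (fS x) : induced [set f y | y in H]).
  apply: inj_card_bij => [x y /(congr1 val)|]; first exact: injf.
  by rewrite /= card_sig card_imset.
by exists (fun x => Sub (f x) (fS x)) => // x y; rewrite -ef.
Qed.

(** * Butterflies *)

(** Adjacency on a cycle, written on [nat] so that [lia] can decide it. *)
Definition cyclic_adj n s t :=
  [|| t == s.+1, s == t.+1, (s == 0) && (t == n.-1) | (t == 0) && (s == n.-1)].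

Lemma ordS_eqE n (a b : 'I_n) :
  (b == ordS a) = (val b == a.+1) || (val b == 0) && (val a == n.-1).
Proof.
rewrite -val_eqE /=; have := ltn_ord a; have := ltn_ord b.
have [lt bn _|le bn an] := ltnP a.+1 n; first by rewrite modn_small //; lia.
have -> : a.+1 = n by lia.
by rewrite modnn; lia.
Qed.

Lemma ordS_adj n (a b : 'I_n) : 2 < n ->
  (a != b) && ((b == ordS a) || (a == ordS b)) = cyclic_adj n a b.
Proof.
by move=> n2; rewrite !ordS_eqE /cyclic_adj -val_eqE /=; lia.
Qed.

Section ButterflyEdges.
Variables i j k : nat.
Hypotheses (i2 : 2 < i) (j2 : 2 < j).
Implicit Types u v : butterfly_vertex i j k.

Lemma butterfly_edgeE u v : butterfly_edge u v =
  match u, v with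
  | inl (inl a), inl (inl b) => cyclic_adj i a b
  | inl (inr a), inl (inr b) => cyclic_adj j a b
  | _, _ => if (path_pos u, path_pos v) is (Some s, Some t)
            then (t == s.+1) || (s == t.+1) else false
  end.
Proof.
have posE s t : path_pos u = Some s -> path_pos v = Some t ->
    (u != v) && ((t == s.+1) || (s == t.+1)) = (t == s.+1) || (s == t.+1).
  move=> us vt; case: eqVneq => //= uv; move: vt; rewrite -uv us => -[->]; lia.
move: posE; rewrite /butterfly_edge /butterfly_arc.
case: u v => [[a|a]|a] [[b|b]|b]; do ?[by move=> _; apply: ordS_adj];
  case: (path_pos _) => [s|]; case: (path_pos _) => [t|] posE; rewrite ?andbF //;
  exact: posE.
Qed.

End ButterflyEdges.

(** * Changing the length of the path of a butterfly *)

Section Slide.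
Variables (i j k k' q : nat).
Hypotheses (i2 : 2 < i) (j2 : 2 < j) (kk' : k <= k'.+1) (q0 : 0 < q) (qk : q <= k).

(** Positions beyond the gap are shifted so that the far end [k] lands on [k']. When the path
    shortens by one, the nearest positions [q - 2] and [q + 1] become [q - 2] and [q], still
    distinct and not adjacent: this is why two consecutive vertices have to be missed. *)
Definition slide_pos s := if s < q then s else s + k' - k.

(* Only meaningful on vertices outside the gap [{q - 1, q}]; the vertex of the
   first cycle in the last line is a junk value. *)
Definition slide (u : butterfly_vertex i j k) : butterfly_vertex i j k' :=
  match u with
  | inl c => inl c
  | inr s => if insub (slide_pos s.+1).-1 is Some t then inr t
             else inl (inl (Ordinal (ltn_trans (isT : 0 < 2) i2)))
  end.

Definition avoids (u : butterfly_vertex i j k) :=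
  path_pos u <> Some q /\ path_pos u <> Some q.-1.

Lemma slide_inr a : avoids (inr a) ->
  exists2 t, slide (inr a) = inr t & t.+1 = slide_pos a.+1.
Proof.
case=> /= H1 H2; have [aq aq1] : a.+1 <> q /\ a.+1 <> q.-1.
  by split=> E; [apply: H1 | apply: H2]; rewrite E.
have ak := ltn_ord a; rewrite /slide; case: insubP => [t _ tE|].
  by exists t; rewrite // tE /slide_pos; case: ifP; lia.
by case/negP; rewrite /slide_pos; case: ifP; lia.
Qed.

Lemma path_pos_slide u : avoids u ->
  path_pos (slide u) = omap slide_pos (path_pos u).
Proof.
case: u => [[a|a]|a].
- by move=> _ /=; case: ifP => //= _; rewrite /slide_pos q0.
- by move=> _ /=; case: ifP => //= _; rewrite /slide_pos ltnNge qk /= addKn.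
by move=> H; have [t -> /= ->] := slide_inr H.
Qed.

Lemma slide_pos_inj s t : s <> q -> t <> q -> s <> q.-1 -> t <> q.-1 ->
  slide_pos s = slide_pos t -> s = t.
Proof. by rewrite /slide_pos; case: ifP; case: ifP; lia. Qed.

Lemma slide_inj u v : avoids u -> avoids v -> slide u = slide v -> u = v.
Proof.
case: u v => [u|a] [v|b] au av; first by case=> ->.
- by have [t ->] := slide_inr av.
- by have [t ->] := slide_inr au.
move=> /(congr1 (@path_pos i j k')); rewrite !path_pos_slide //= => -[E].
move: au av => [/= H1 H2] [/= H3 H4]; congr inr; apply/val_inj.
suff [] : a.+1 = b.+1 by [].
by apply: slide_pos_inj E => E; [apply: H1 | apply: H3 | apply: H2 | apply: H4];
  rewrite E.
Qed.

Lemma slide_edge u v : avoids u -> avoids v ->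
  butterfly_edge (slide u) (slide v) = butterfly_edge u v.
Proof.
move=> au av; rewrite !butterfly_edgeE //.
have adjE :
    (if (path_pos (slide u), path_pos (slide v)) is (Some s, Some t)
     then (t == s.+1) || (s == t.+1) else false) =
    (if (path_pos u, path_pos v) is (Some s, Some t)
     then (t == s.+1) || (s == t.+1) else false).
  rewrite !path_pos_slide //; move: au av; rewrite /avoids.
  case: (path_pos u) => [s|] //; case: (path_pos v) => [t|] //=.
  move=> [H1 H2] [H3 H4].
  have : [/\ s <> q, s <> q.-1, t <> q & t <> q.-1].
    by split=> E; [apply: H1 | apply: H2 | apply: H3 | apply: H4]; rewrite E.
  case=> {}H1 {}H2 {}H3 {}H4; rewrite /slide_pos.
  by case: ifP; case: ifP; lia.
case: u v au av adjE => [[a|a]|a] [[b|b]|b] au av //;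
  by [have [t ->] := slide_inr av | have [t ->] := slide_inr au
     | have [t -> _] := slide_inr au; have [t' -> _] := slide_inr av].
Qed.

End Slide.

(** Pigeonhole: the [#|T| + 1] pairs of positions [2e], [2e + 1] are disjoint and fit on the path,
    so one of them is missed by [f]. *)
Lemma free_gap (T : finType) i j k (f : T -> butterfly_vertex i j k) :
  2 * #|T| < k -> exists q, [/\ 0 < q, q <= k & forall x, avoids q (f x)].
Proof.
move=> Tk; apply: contrapT => H.
have used (e : 'I_#|T|.+1) : exists x,
    path_pos (f x) = Some e.*2.+1 \/ path_pos (f x) = Some e.*2.
  apply: contrapT => nx; apply: H; exists e.*2.+1; split=> //.
    by have := ltn_ord e; lia.
  by move=> x; split=> E; apply: nx; exists x; [left | right].
have [g gP] := choice used.
have : injective g.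
  move=> e e' E; apply: val_inj => /=; have := gP e; rewrite E.
  by case: (gP e') => -> [] [] //; lia.
by move/leq_card; rewrite card_ord ltnn.
Qed.

Lemma butterfly_slide (H : sgraph) i j k k' : 2 < i -> 2 < j ->
  2 * #|H| < k -> k <= k'.+1 ->
  is_induced_subgraph H (butterfly i j k) ->
  is_induced_subgraph H (butterfly i j k').
Proof.
move=> i2 j2 Hk kk' /is_induced_subgraphP[f [injf ef]].
have [q [q0 qk av]] := free_gap f Hk.
apply/is_induced_subgraphP; exists (fun x => slide k' q i2 (f x) : butterfly i j k').
split=> [x y /slide_inj E|x y]; first by apply: injf; apply: E.
by rewrite -ef; apply: slide_edge.
Qed.

(** A slide shortens the path by at most one, so the length decreases step by step, with a new gap
    each time. *)
Lemma butterfly_shrink (H : sgraph) i j k k' : 2 < i -> 2 < j ->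
  2 * #|H| < k' -> k' <= k ->
  is_induced_subgraph H (butterfly i j k) ->
  is_induced_subgraph H (butterfly i j k').
Proof.
move=> i2 j2 Hk' /subnKC <-; elim: (k - k') => [|n IH]; first by rewrite addn0.
by move=> HB; apply: IH; apply: butterfly_slide HB => //; lia.
Qed.

(** * Branching vertices and butterflies *)

Section EndGadgets.
Variable G : sgraph.
Hypothesis conG : connected G.
Implicit Types (a b x y : G) (c g p w : nat -> G) (X Y : {set G}).

(* An end of the path [p_0, ..., p_k] where any [m] vertices of some cycle of a
   butterfly can be realised within distance [r] of [a]: the cycle itself may
   be absent from [G], since [g] depends on the vertices [U] to be realised. *)
Definition end_gadget m r a p k := exists i, 2 < i /\
  forall U : {set 'I_i}, #|U| <= m -> exists g, [/\ g 0 = p 0,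
    forall e : 'I_i, e \in U -> dist a (g e) <= r,
    forall e e' : 'I_i, e \in U -> e' \in U ->
      (g e = g e' -> e = e') /\ edge (g e) (g e') = cyclic_adj i e e' &
    forall e : 'I_i, e \in U -> val e <> 0 -> forall s, 0 < s -> s <= k ->
      g e <> p s /\ ~~ edge (g e) (p s)].

Lemma end_gadget_sub m r a p k p' k' : end_gadget m r a p k -> k' <= k ->
  (forall s, s <= k' -> p' s = p s) -> end_gadget m r a p' k'.
Proof.
move=> [i [i2 H]] k'k E; exists i; split=> // U /H[g [H1 H2 H3 H4]].
exists g; split=> //; first by rewrite E.
by move=> e eU e0 s s0 sk; rewrite E //; apply: H4 => //; lia.
Qed.

(** The cycle of the butterfly is [c] itself, which serves every [U] at once. *)
Lemma end_gadget_chordless m r a p k n c : cycle_fun n c -> chordless n c ->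
  c 0 = p 0 -> (forall e, e < n -> dist a (c e) <= r) ->
  (forall e, 0 < e -> e < n -> forall s, 0 < s -> s <= k ->
     c e <> p s /\ ~~ edge (c e) (p s)) ->
  end_gadget m r a p k.
Proof.
move=> cc ch c0 cr cp; have [n2 st cl inj] := cc.
exists n; split=> // U _; exists c; split=> //; first by move=> e _; apply: cr.
  move=> e e' _ _; split; first by move/inj => H; apply: val_inj; apply: H.
  have := ltn_ord e; have := ltn_ord e'; move: (val e) (val e') => s t tn sn.
  wlog st' : s t sn tn / s <= t => [H|].
    by case: (leqP s t) => [|/ltnW] /H E; rewrite ?E // edge_sym E // /cyclic_adj; lia.
  move: st'; rewrite leq_eqVlt => /predU1P[->|lt_st].
    by rewrite edge_irr /cyclic_adj; lia.
  apply/idP/idP => [/(ch _ _ lt_st tn)|]; rewrite /cyclic_adj; first lia.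
  move=> H; have [->|[-> ->]] : t = s.+1 \/ s = 0 /\ t = n.-1 by lia.
    by apply: st; lia.
  by rewrite edge_sym.
by move=> e _ /eqP; rewrite -lt0n => e0; apply: cp.
Qed.

Definition geodesic_upto p k :=
  forall s t, s <= t -> t <= k -> dist (p s) (p t) = t - s.

(** Two rays from [a] that avoid [p 1] form, with [p], the three legs. A set of at most [m] vertices
    of the cycle of length [m + 3] misses some [h] other than 0; cutting there leaves two arcs from
    0, which are laid along the two rays. *)
Lemma end_gadget_legs m a p k : branching a -> acyclic (ball a (m + 3)) ->
  p 0 = a -> geodesic_upto p k -> m + 3 <= k -> end_gadget m (m + 3) a p k.
Proof.
move=> ba acX p0 gp mk.
have [x [w [w0 w1 nbw]] [xp _]] := ba (p 1) (p 1).
have [y [w' [w'0 w'1 nbw']] [yp yx]] := ba (p 1) x.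
have distw u : u 0 = a -> (forall n, nb_walk n u) -> forall s, dist a (u s) <= s.
  move=> u0 nbu; elim=> [|s IH]; first by rewrite u0 distxx.
  have [/(_ s (leqnn _)) + _] := nbu s.+1; rewrite edge_dist // => /eqP E.
  by have := dist_trans conG (u s) a (u s.+1); lia.
have inX u : u 0 = a -> (forall n, nb_walk n u) ->
    forall s, s <= m + 3 -> u s \in ball a (m + 3).
  move=> u0 nbu s sm; rewrite -dist_le //.
  by have := distw u u0 nbu s; lia.
have dp s : s <= k -> dist a (p s) = s by move=> sk; rewrite -p0 gp // subn0.
have nbp : nb_walk (m + 3) p.
  split=> s sk; first by rewrite edge_dist // gp //; lia.
  by move=> E; have := gp s s.+2; rewrite E distxx //; lia.
have pX s : s <= m + 3 -> p s \in ball a (m + 3).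
  by move=> sm; rewrite -dist_le // dp //; lia.
(* Inside the ball acyclicity separates a leg from [p]; a vertex of [p] outside the ball is at least
   2 farther from [a] than the leg. *)
have far u : u 0 = a -> (forall n, nb_walk n u) -> u 1 <> p 1 ->
    forall e s, 0 < e -> e < m + 3 -> 0 < s -> s <= k ->
    u e <> p s /\ ~~ edge (u e) (p s).
  move=> u0 nbu u1 e s e0 em s0 sk; case: (leqP s (m + 3)) => sm.
    have [|||ne ->] := nb_walks_acyclic acX (nbu (m + 3)) nbp (inX u u0 nbu) pX _ u1
        (s := e) (t := s); rewrite ?u0 ?p0 //; try lia.
    by split=> [/ne|]; lia.
  have de := distw u u0 nbu e; have ds := dp s sk; split=> [E|].
    by move: de; rewrite E; lia.
  rewrite edge_dist //; apply/eqP => E.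
  by have := dist_trans conG (u e) a (p s); lia.
exists (m + 3); split; first lia.
move=> U Um.
have [h hU h0] : exists2 h : 'I_(m + 3), h \notin U & val h <> 0.
  have i0 : 0 < m + 3 by lia.
  apply: contrapT => H; have : [set: 'I_(m + 3)] \subset Ordinal i0 |: U.
    apply/subsetP => h _; rewrite !inE; apply: contrapT => /negP.
    rewrite negb_or => /andP[h0 hU]; apply: H; exists h => // /eqP.
    by apply/negP; rewrite -val_eqE in h0.
  move/subset_leq_card; rewrite cardsT card_ord cardsU1.
  by move: Um; case: (_ \notin _) => /=; lia.
exists (fun e => if e < h then w e else w' (m + 3 - e)).
have neh e : e \in U -> val e <> val h.
  by move=> eU /val_inj E; rewrite -E eU in hU.
split.
- by rewrite lt0n; case: eqP => // _; rewrite w0.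
- move=> e eU; have := ltn_ord e; case: ifP => _ em.
    by have := distw w w0 nbw e; lia.
  by have := distw w' w'0 nbw' (m + 3 - e); lia.
- move=> e e' eU e'U; have := neh _ eU; have := neh _ e'U.
  have := ltn_ord e; have := ltn_ord e'; have := ltn_ord h.
  suff H s t : s < m + 3 -> t < m + 3 -> s <> h -> t <> h ->
    (((if s < h then w s else w' (m + 3 - s)) =
      (if t < h then w t else w' (m + 3 - t))) -> s = t) /\
    edge (if s < h then w s else w' (m + 3 - s))
         (if t < h then w t else w' (m + 3 - t)) = cyclic_adj (m + 3) s t.
    move=> _ *; have [|||| H1 H2] := H e e' => //.
    by split=> // /H1 E; apply: val_inj.
  have {}h0 : nat_of_ord h <> 0 := h0.
  have hm := ltn_ord h; move: (nat_of_ord h) h0 hm => {neh hU h} h h0 hm.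
  wlog st : s t / s <= t => [H|].
    case: (leqP s t) => [st|/ltnW ts] *; first exact: H.
    have [|||||H1 H2] := H t s => //.
    split=> [/esym/H1 //|]; rewrite edge_sym H2 /cyclic_adj; lia.
  move: st; rewrite leq_eqVlt => /predU1P[->|st] sm tm sh th.
    by rewrite edge_irr /cyclic_adj; split=> //; lia.
  have [th'|ht] := ltnP t h.
    rewrite (ltn_trans st th').
    have [|ne ->] := nb_walk_acyclic acX (nbw (m + 3)) (inX w w0 nbw) st; try lia.
    by rewrite /cyclic_adj; split=> [/ne|]; lia.
  have [sh'|hs] := ltnP s h.
    have [||||ne ->] := nb_walks_acyclic acX (nbw (m + 3)) (nbw' (m + 3))
        (inX w w0 nbw) (inX w' w'0 nbw') _ _ (s := s) (t := m + 3 - t);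
        rewrite ?w0 ?w1 ?w'0 ?w'1 //; try lia; first exact/nesym.
    by rewrite /cyclic_adj; split=> [/ne|]; lia.
  have [||ne E] := nb_walk_acyclic acX (nbw' (m + 3)) (inX w' w'0 nbw')
      (s := m + 3 - t) (t := m + 3 - s); try lia.
  by rewrite edge_sym E /cyclic_adj; split=> [/esym/ne|]; lia.
move=> e eU /= e0 s s0 sk; have em := ltn_ord e; case: ifP => eh.
  by apply: far; rewrite ?w1 //; lia.
by apply: far; rewrite ?w'1 //; lia.
Qed.

(** From [p 2] on, the path is not adjacent to the cycle, so only [p 1] can disturb. If it has a
    second neighbour [c e] on the cycle, the gadget is based at [p 1] instead ([t = 1]), which lies
    within [r.+1] of [a]; otherwise it is based at [c 0]. *)
Lemma end_gadget_cycle m r a p k n c : cycle_fun n c -> p 0 = c 0 ->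
  (forall e, e < n -> dist a (c e) <= r) -> 0 < k ->
  geodesic_upto p k ->
  (forall e s, e < n -> s <= k -> s <= dist (c e) (p s)) ->
  exists2 t, t <= 1 & end_gadget m r.+1 a (fun s => p (t + s)) (k - t).
Proof.
move=> cc p0 cr k0 gp far; have [n2 st cl inj] := cc.
have far2 e s : e < n -> 1 < s -> s <= k -> c e <> p s /\ ~~ edge (c e) (p s).
  move=> en s1 sk; have := far e s en sk; rewrite edge_dist //.
  by split=> [E|]; [move: H; rewrite E distxx //|]; lia.
have [[e [e0 en ep1]]|H] := pselect (exists e, [/\ 0 < e, e < n & edge (c e) (p 1)]).
  (* The cycle through [p 1], [c 0], ..., [c e], to be made chordless while keeping [p 1]. *)
  have cc' : cycle_fun e.+2 (fun s => if s is s'.+1 then c s' else p 1).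
    split=> //; first by case=> [|s] sn; [rewrite -p0 edge_dist // dist_sym // gp|apply: st; lia].
    have p1c s : s < n -> p 1 <> c s.
      by move=> sn E; have := far s 1 sn k0; rewrite E distxx.
    by case=> [|s] [|t] sn tn // => [/p1c|/esym/p1c|/inj]; lia.
  pose X := p 1 |: [set c s | s : 'I_n].
  have [|n' [c' [cc'' c'0 c'X ch]]] := chordless_cycle (X := X) cc'.
    case=> [|s] sn; first by rewrite !inE eqxx.
    have sn' : s < n by lia.
    by rewrite !inE; apply/orP; right; apply/imsetP; exists (Ordinal sn').
  exists 1 => //; apply: (end_gadget_chordless _ cc'' ch) => //.
    move=> s /c'X; rewrite !inE => /orP[/eqP->|/imsetP[i _ ->]].
      have := dist_trans conG (p 0) a (p 1); rewrite gp // p0.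
      by have := cr 0; lia.
    by have := cr i (ltn_ord i); lia.
  move=> f f0 fn s s0 sk; have /c'X := fn; rewrite !inE.
  case/orP => [/eqP E|/imsetP[i _ ->]]; last by apply: far2 => //; lia.
  by have := cyc_inj cc'' fn (ltnW (leq_ltn_trans f0 fn)); rewrite E c'0 => /(_ erefl); lia.
exists 0 => //; pose X := [set c s | s : 'I_n].
have [|n' [c' [cc'' c'0 c'X ch]]] := chordless_cycle (X := X) cc.
  by move=> s sn; apply/imsetP; exists (Ordinal sn).
apply: end_gadget_sub (leq_subr _ _) (fun s _ => erefl _).
apply: (end_gadget_chordless _ cc'' ch).
- by rewrite c'0.
- by move=> s /c'X/imsetP[i _ ->]; have := cr i (ltn_ord i); lia.
move=> f f0 fn s s0 sk; have /imsetP[i _ E] := c'X _ fn.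
have i0 : 0 < i.
  rewrite lt0n; apply/eqP => i0.
  have := cyc_inj cc'' fn (ltnW (leq_ltn_trans f0 fn)); rewrite E c'0 i0 => /(_ erefl); lia.
rewrite E add0n; case: (ltnP 1 s) => s1; first by apply: far2.
have -> : s = 1 by lia.
split=> [E1|]; first by have := far i 1 (ltn_ord i) k0; rewrite E1 distxx.
by apply/negP => e; apply: H; exists i.
Qed.

(** [Y] is [[set a]] if the ball of radius [m + 3] is acyclic, and the vertex set of a cycle inside
    it otherwise. It is fixed before [p], so that [p] can be chosen as a shortest path between two
    such sets. *)
Lemma end_core m a : branching a -> exists Y,
  [/\ exists y, y \in Y, {in Y, forall y, dist a y <= m + 3} &
    forall p k, m + 3 <= k -> p 0 \in Y -> geodesic_upto p k ->
      (forall y s, y \in Y -> s <= k -> s <= dist y (p s)) ->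
      exists2 t, t <= 1 & end_gadget m (m + 4) a (fun s => p (t + s)) (k - t)].
Proof.
move=> ba; have [acX|] := pselect (acyclic (ball a (m + 3))).
  exists [set a]; split; first by exists a; rewrite inE.
    by move=> y; rewrite inE => /eqP->; rewrite distxx.
  move=> p k mk; rewrite inE => /eqP p0 gp _; exists 0 => //.
  apply: end_gadget_sub (leq_subr _ _) (fun s _ => erefl _).
  have [i [i2 H]] := end_gadget_legs ba acX p0 gp mk.
  exists i; split=> // U /H[g [H1 H2 H3 H4]]; exists g; split=> //.
  by move=> e /H2; lia.
move=> nac; have [n [c [cc inX]]] : exists n c,
    cycle_fun n c /\ forall s, s < n -> c s \in ball a (m + 3).
  apply: contrapT => H; apply: nac => n c cc; apply: contrapT => H'; apply: H.
  exists n, c; split=> // s sn; apply: contrapT => /negP nX.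
  by apply: H'; exists s.
have n0 : 0 < n by have := cyc_size cc; lia.
exists [set c s | s : 'I_n]; split.
- by exists (c 0); apply/imsetP; exists (Ordinal n0).
- by move=> y /imsetP[i _ ->]; rewrite dist_le // inX.
move=> p k mk /imsetP[i _ p0] gp far.
have [c' [cc' c'0 c'c]] := cycle_rot cc (ltn_ord i).
have -> : m + 4 = (m + 3).+1 by lia.
apply: (end_gadget_cycle _ cc') => //; try lia.
- by rewrite c'0.
- by move=> e /c'c[t tn ->]; rewrite dist_le // inX.
move=> e s /c'c[t tn ->] sk; apply: far => //; apply/imsetP.
by exists (Ordinal tn).
Qed.

End EndGadgets.

(** * Distant branching vertices yield a member of the family *)

Section CoveringFamily.
Variables (I : finType) (F : I -> sgraph).
Hypothesis cov : forall i j, 2 < i -> 2 < j -> covers F i j.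

Let m := \max_(h : I) #|F h|.

Lemma card_le_max h : #|F h| <= m.
Proof. exact: (leq_bigmax h). Qed.

Variable G : sgraph.
Hypothesis conG : connected G.
Implicit Types (a b : G) (p : nat -> G).

Lemma butterfly_realised r a b p k : covering_length F <= k ->
  geodesic_upto p k -> end_gadget m r a p k ->
  end_gadget m r b (fun s => p (k - s)) k -> r + r + 1 < dist a b ->
  exists h, is_induced_subgraph (F h) G.
Proof.
move=> Nk gp [i [i2 HL]] [j [j2 HR]] rab.
have [h Hh] := cov i2 j2; exists h.
have hm := card_le_max h.
have : is_induced_subgraph (F h) (butterfly i j k).
  by apply: butterfly_slide Hh => //; move: Nk; rewrite /covering_length -/m; lia.
case/is_induced_subgraphP => f [injf ef].
have k0 : 0 < k by move: Nk; rewrite /covering_length; lia.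
(* The gadgets only have to realise the at most [m] cycle vertices that the copy of [F h] uses on
   each side. *)
pose UL := [set e : 'I_i | [exists x, f x == inl (inl e)]].
pose UR := [set e : 'I_j | [exists x, f x == inl (inr e)]].
have cardU (T : finType) (g : T -> butterfly_vertex i j k) : injective g ->
    #|[set e : T | [exists x, f x == g e]]| <= m.
  move=> injg; apply: leq_trans hm; rewrite -(card_imset _ injg) -(card_imset _ injf).
  apply/subset_leq_card/subsetP => u /imsetP[e]; rewrite inE => /existsP[x /eqP fx] ->.
  by rewrite -fx; apply: imset_f.
have [gL [gL0 gLr gLe gLp]] := HL UL (cardU _ (fun e => inl (inl e)) (fun _ _ '(erefl) => erefl)).
have [gR [gR0 gRr gRe gRp]] := HR UR (cardU _ (fun e => inl (inr e)) (fun _ _ '(erefl) => erefl)).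
pose phi (u : butterfly_vertex i j k) := match u with
  | inl (inl e) => gL e | inl (inr e) => gR e | inr s => p s.+1 end.
have inUL x e : f x = inl (inl e) -> e \in UL.
  by move=> E; rewrite inE; apply/existsP; exists x; rewrite E.
have inUR x e : f x = inl (inr e) -> e \in UR.
  by move=> E; rewrite inE; apply/existsP; exists x; rewrite E.
pose good u v := (phi u = phi v -> u = v) /\ edge (phi u) (phi v) = butterfly_edge u v.
have good_sym u v : good u v -> good v u.
  by case=> H1 H2; split=> [/esym/H1 //|]; rewrite edge_sym H2 butterfly_edge_sym.
have pp s t : s <= k -> t <= k -> (p s = p t -> s = t) /\
    edge (p s) (p t) = (t == s.+1) || (s == t.+1).
  wlog st : s t / s <= t => [H sk tk|sk tk].
    case: (leqP s t) => [|/ltnW] st; first exact: H.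
    by have [H1 H2] := H _ _ st tk sk; split=> [/esym/H1 //|]; rewrite edge_sym H2 orbC.
  have := gp s t st tk => d; rewrite edge_dist // d; split; last lia.
  by move=> E; move: d; rewrite E distxx //; lia.
have gLk e s : e \in UL -> 0 < s -> s <= k ->
    gL e <> p s /\ edge (gL e) (p s) = (val e == 0) && (s == 1).
  move=> eU s0 sk; case: (eqVneq (val e) 0) => [|/eqP] e0.
    have -> : gL e = p 0 by rewrite -gL0 -e0.
    by have [H ->] := pp 0 s (leq0n _) sk; split=> [/H|]; lia.
  by have [H1 /negbTE ->] := gLp e eU e0 s s0 sk.
have gRk e s : e \in UR -> s < k ->
    gR e <> p s /\ edge (gR e) (p s) = (val e == 0) && (s.+1 == k).
  move=> eU sk; case: (eqVneq (val e) 0) => [|/eqP] e0.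
    have -> : gR e = p k by rewrite -(subn0 k) -gR0 -e0.
    by have [H ->] := pp k s (leqnn _) (ltnW sk); split=> [/H|]; lia.
  have [|| H1 /negbTE H2] := gRp e eU e0 (k - s); try lia.
  by move: H1 H2; rewrite subKn ?(ltnW sk) // => ? ->.
have inn (s : 'I_k.-1) : s.+1 < k by have := ltn_ord s; lia.
have goodLI x e s : f x = inl (inl e) -> good (inl (inl e)) (inr s).
  move=> /inUL eU; have [H1 H2] := gLk e s.+1 eU isT (ltnW (inn s)).
  split=> //; rewrite H2 butterfly_edgeE //=.
  by case: eqP => //= _; lia.
have goodRI x e s : f x = inl (inr e) -> good (inl (inr e)) (inr s).
  move=> /inUR eU; have [H1 H2] := gRk e s.+1 eU (inn s).
  split=> //; rewrite H2 butterfly_edgeE //=.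
  by case: eqP => //= _; have := inn s; lia.
have goodLR x y e e' : f x = inl (inl e) -> f y = inl (inr e') ->
    good (inl (inl e)) (inl (inr e')).
  move=> /inUL eU /inUR e'U; rewrite /good butterfly_edgeE //=.
  have [e'0|e'0] := eqVneq (val e') 0.
    have -> : gR e' = p k by rewrite -(subn0 k) -gR0 -e'0.
    have [H1 H2] := gLk e k eU k0 (leqnn _); split=> //; rewrite H2.
    by case: eqP => //= _; lia.
  have [e0|e0] := eqVneq (val e) 0.
    have -> : gL e = p 0 by rewrite -gL0 -e0.
    have [H1 H2] := gRk e' 0 e'U k0; split; first by move/esym.
    by rewrite edge_sym H2 (negbTE e'0).
  (* These two vertices lie within [r] of [a] and of [b], hence at distance at least 2 from each
     other. *)
  have d1 := gLr e eU; have d2 := gRr e' e'U.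
  have d3 := dist_trans conG (gL e) a b; have d4 := dist_trans conG (gR e') (gL e) b.
  rewrite (dist_sym conG (gR e')) in d4; split=> [E|].
    by move: d4; rewrite E distxx //; rewrite E in d1 d3; lia.
  by rewrite edge_dist //; apply/eqP => E; lia.
apply/is_induced_subgraphP; exists (phi \o f).
suff H x y : good (f x) (f y).
  by split=> x y; have [H1 H2] := H x y; [move/H1/injf | rewrite /= H2; apply: ef].
case fx : (f x) => [[e|e]|s]; case fy : (f y) => [[e'|e']|t].
- have [H1 H2] := gLe e e' (inUL _ _ fx) (inUL _ _ fy).
  by split=> [/H1 -> //|]; rewrite butterfly_edgeE.
- exact: goodLR fx fy.
- exact: goodLI fx.
- by apply: good_sym; apply: goodLR fy fx.
- have [H1 H2] := gRe e e' (inUR _ _ fx) (inUR _ _ fy).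
  by split=> [/H1 -> //|]; rewrite butterfly_edgeE.
- exact: goodRI fx.
- by apply: good_sym; apply: goodLI fy.
- by apply: good_sym; apply: goodRI fy.
have [H1 H2] := pp s.+1 t.+1 (ltnW (inn s)) (ltnW (inn t)).
split; last by rewrite butterfly_edgeE.
by move/H1 => -[E]; congr inr; apply: val_inj.
Qed.

(** Leaves room for both cores, which take up at most [2 * m + 6], for a path of length
    [covering_length F] after trimming one edge at each end, and for separated gadgets of radius
    [m + 4]. The constant is generous. *)
Definition branching_bound := 4 * m + covering_length F + 20.

Lemma branching_close a b : free_of F G -> branching a -> branching b ->
  dist a b <= branching_bound.
Proof.
move=> free ba bb; rewrite leqNgt; apply/negP => dab.
have [Ya [[ya yaY] Yad Yag]] := end_core conG m ba.
have [Yb [[yb ybY] Ybd Ybg]] := end_core conG m bb.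
(* A geodesic between a closest pair moves away from both cores at full speed, as [end_core]
   requires at either end. *)
have [[x y] /andP[/= xY yY] xymin] := arg_minnP
  (P := fun z : G * G => (z.1 \in Ya) && (z.2 \in Yb)) (i0 := (ya, yb))
  (fun z : G * G => dist z.1 z.2) (introT andP (conj yaY ybY)).
have {}xymin u v : u \in Ya -> v \in Yb -> dist x y <= dist u v.
  by move=> uY vY; apply: (xymin (u, v)); rewrite /= uY.
have kd : dist a b <= m + 3 + dist x y + (m + 3).
  have := Yad x xY; have := Ybd y yY; have := dist_trans conG x a b.
  by have := dist_trans conG y x b; rewrite (dist_sym conG y b); lia.
have [p [p0 pk gp]] := geodesic conG x y.
set k := dist x y in xymin kd pk gp; rewrite /branching_bound in dab.
have [||||t1 t1le g1] := Yag p k; rewrite ?p0 //; try lia.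
  move=> u s uY sk; have := xymin u y uY yY; have := gp s k sk (leqnn _).
  by rewrite pk; have := dist_trans conG (p s) u y; lia.
have [||||t2 t2le g2] := Ybg (fun s => p (k - s)) k; rewrite ?subn0 ?pk //; try lia.
- by move=> s t st tk; rewrite dist_sym // gp; lia.
- move=> u s uY sk; have := xymin x u xY uY; have := gp 0 (k - s) (leq0n _) (leq_subr _ _).
  by rewrite p0 (dist_sym conG u); have := dist_trans conG (p (k - s)) x u; lia.
have [||||| h] := @butterfly_realised (m + 4) a b (fun s => p (t1 + s)) (k - t1 - t2);
  last exact: free.
- by lia.
- by move=> s t st tk; rewrite gp; lia.
- by apply: end_gadget_sub g1 _ _ => //; lia.
- apply: end_gadget_sub g2 _ _; first lia.
  by move=> s sk; congr p; lia.
by lia.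
Qed.

End CoveringFamily.

(** * Connected feedback vertex sets *)

Lemma connected_rooted (G : sgraph) (a : G) (f : G -> nat) :
  (forall y, y <> a -> exists2 z, edge z y & f z < f y) -> connected G.
Proof.
move=> H; have ca y : connect (@edge G) a y.
  have [n] := ubnP (f y); elim: n y => // n IH y yn.
  have [->|/eqP/H[z e zy]] := eqVneq y a; first exact: connect0.
  by apply: connect_trans (IH z _) (connect1 e); lia.
have sym : connect_sym (@edge G) by apply: sym_connect_sym; apply: edge_sym.
by move=> x y; apply: connect_trans (ca y); rewrite sym.
Qed.

Section FeedbackVertexSets.
Variable G : sgraph.
Implicit Types (a x : G) (S T : {set G}).

Lemma is_fvs_setT : is_fvs [set: G].
Proof.
by apply/is_fvsP => n c cc; exists 0; rewrite ?inE //; have := cyc_size cc; lia.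
Qed.

Lemma fvs_le S : is_fvs S -> fvs G <= #|S|.
Proof.
move=> fS; rewrite /fvs; case: arg_minnP => [|T _]; first exact/asboolP/is_fvs_setT.
by apply; apply/asboolP.
Qed.

Lemma fvs_witness : exists2 S : {set G}, is_fvs S & #|S| = fvs G.
Proof.
rewrite /fvs; case: arg_minnP => [|T /asboolP fT _]; last by exists T.
exact/asboolP/is_fvs_setT.
Qed.

Lemma is_fvs_sub S T : is_fvs S -> S \subset T -> is_fvs T.
Proof.
move=> /is_fvsP fS /subsetP ST; apply/is_fvsP => n c /fS[s sn cS].
by exists s => //; apply: ST.
Qed.

Hypothesis conG : connected G.

(** Makes the default value in [cfvs] legitimate, as [arg_minnP] demands. *)
Lemma is_cfvs_setT : is_cfvs [set: G].
Proof.
split; first exact: is_fvs_setT.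
move=> x; apply: (@connected_rooted _ x (fun y => dist (val x) (val y))) => y yx.
case d : (dist (val x) (val y)) => [|n].
  by case: yx; apply/val_inj/esym/eqP; rewrite -(dist_eq0 conG) d.
have [z e dz] := dist_parent conG d; have zT : z \in [set: G] by rewrite inE.
by exists (Sub z zT); rewrite /= ?dz // /induced_edge edge_sym.
Qed.

Lemma cfvs_le S : is_cfvs S -> cfvs G <= #|S|.
Proof.
move=> fS; rewrite /cfvs; case: arg_minnP => [|T _]; first exact/asboolP/is_cfvs_setT.
by apply; apply/asboolP.
Qed.

Lemma cfvs_witness : exists2 S : {set G}, is_cfvs S & #|S| = cfvs G.
Proof.
rewrite /cfvs; case: arg_minnP => [|T /asboolP fT _]; last by exists T.
exact/asboolP/is_cfvs_setT.
Qed.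

(* A cycle through a vertex [v] far from [a] also passes through the parent of
   [v], as otherwise [v] would be branching. *)
Lemma fvs_toward a D n S : branching a ->
  (forall b, branching b -> dist a b <= D) ->
  is_fvs S -> (forall x, x \in S -> dist a x <= D + n) ->
  exists T, [/\ is_fvs T, #|T| <= #|S| & forall x, x \in T -> dist a x <= D].
Proof.
move=> ba bD; elim: n S => [|n IH] S fS SD; first by exists S; rewrite addn0 in SD.
(* Vertices already within [D] stay; the others move one step closer to [a]. *)
have parent x : exists u, if dist a x <= D then u = x
    else edge x u /\ (dist a u).+1 = dist a x.
  case: leqP => [_|]; first by exists x.
  case d : (dist a x) => [|k] // _; have [u e du] := dist_parent conG d.
  by exists u; rewrite du.
have [f fP] := choice parent.
have [|x|T [fT Tc TD]] := IH [set f x | x in S].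
- apply/is_fvsP => k c cc; have /is_fvsP/(_ k c cc)[s sk sS] := fS.
  have := fP (c s); case: ifP => [_ E|/negbT xD [e d]].
    by exists s => //; rewrite -E imset_f.
  have [c' [cc' c'0 c'c]] := cycle_rot cc sk.
  apply: contrapT => H; move/negP: xD; apply; apply: bD; rewrite -c'0.
  apply: (cycle_avoiding_parent_branching (u := f (c s)) conG ba cc' _ _ (erefl _)).
  + by rewrite c'0 d.
  + by rewrite c'0.
  move=> t /c'c[t' t'k ->] E; apply: H; exists t' => //.
  by rewrite E imset_f.
- case/imsetP => y yS ->; have := fP y; have := SD y yS; case: ifP => [? _ ->|]; lia.
by exists T; split=> //; apply: leq_trans Tc (leq_imset_card _ _).
Qed.

Lemma connected_join a D S : (forall x, x \in S -> dist a x <= D) ->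
  exists T, [/\ S \subset T, connected (induced T) & #|T| <= 1 + #|S| * D.+1].
Proof.
move=> SD; have [p pP] := choice (geodesic conG a).
(* Each geodesic from [a] is indexed by [D.+1] values, shorter ones repeating their last vertex;
   this gives the count. *)
pose q (z : G * 'I_D.+1) := p z.1 (minn z.2 (dist a z.1)).
pose T := a |: [set q z | z in setX S [set: 'I_D.+1]].
have qT x s : x \in S -> s <= dist a x ->
    p x s \in T.
  move=> xS sd; have sD : s < D.+1 by have := SD x xS; lia.
  rewrite !inE; apply/orP; right; apply/imsetP; exists (x, Ordinal sD).
    by rewrite !inE xS.
  by rewrite /q /= (minn_idPl sd).
exists T; split.
- apply/subsetP => x xS; have [_ <- _] := pP x; exact: qT.
- have aT : a \in T by rewrite !inE eqxx.
  apply: (@connected_rooted (induced T) (Sub a aT) (fun y => dist a (val y))) => y ya.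
  have := valP y; rewrite !inE => /orP[/eqP E|]; first by case: ya; apply: val_inj.
  case/imsetP => -[x i]; rewrite !inE andbT /= => xS yE.
  have [p0 pd gp] := pP x.
  have {}yE : val y = p x (minn i (dist a x)) := yE.
  move: yE; move: (minn _ _) (geq_minr i (dist a x)) => [|s] sd yE.
    by case: ya; apply: val_inj; rewrite yE.
  have sT := qT x s xS (ltnW sd); exists (Sub (p x s) sT).
    by rewrite /= /induced_edge yE edge_dist // gp //; lia.
  by rewrite yE -[a]p0 /= !gp //; lia.
rewrite cardsU1; apply: leq_add; first by case: (_ \notin _).
by apply: leq_trans (leq_imset_card _ _) _; rewrite cardsX cardsT card_ord.
Qed.

Lemma cfvs_le_fvs1 : fvs G = 1 -> cfvs G <= 1.
Proof.
move=> f1; have [S fS] := fvs_witness; rewrite f1 => S1; rewrite -S1.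
apply: cfvs_le; split=> // x y; move/eqP/cards1P: S1 => [z Sz].
suff -> : x = y by apply: connect0.
have Sv u : u \in S -> u = z by rewrite Sz inE => /eqP.
by apply: val_inj; rewrite (Sv _ (valP x)) (Sv _ (valP y)).
Qed.

(** No single vertex meets all cycles, so some cycle avoids a chosen vertex [c 0] of another one. *)
Lemma branching_exists : 1 < fvs G -> exists a : G, branching a.
Proof.
move=> f2; have cyc_avoid S : #|S| <= 1 ->
    exists n c, cycle_fun n c /\ forall s, s < n -> c s \notin S.
  move=> S1; apply: contrapT => H; have : fvs G <= #|S|; last lia.
  apply/fvs_le/is_fvsP => n c cc; apply: contrapT => H'; apply: H; exists n, c.
  by split=> // s sn; apply/negP => cS; apply: H'; exists s.
have [n [c [cc _]]] := cyc_avoid set0 ltac:(by rewrite cards0).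
have [n' [c' [cc' av]]] := cyc_avoid [set c 0] ltac:(by rewrite cards1).
by apply: (two_cycles_branching conG cc cc') => s /av; rewrite inE => /eqP.
Qed.

End FeedbackVertexSets.

(** With [D] the branching bound, each vertex of a minimum feedback vertex set costs [D + 1]
    vertices, and the extra one for [a] is absorbed since [fvs G] is positive. The case [fvs G = 1]
    is separate, as a branching vertex may be missing. *)
Lemma covers_cfvs_bounded (I : finType) (F : I -> sgraph) (G : sgraph) :
  (forall i j, 2 < i -> 2 < j -> covers F i j) ->
  connected G -> free_of F G -> 0 < fvs G ->
  cfvs G <= (branching_bound F + 2) * fvs G.
Proof.
move=> cov conG free f0; case: (ltngtP (fvs G) 1) => [|f2|f1]; first lia.
  have [a ba] := branching_exists conG f2.
  have bD b : branching b -> dist a b <= branching_bound F.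
    exact: branching_close.
  have [S fS Sc] := fvs_witness G.
  have [|T [fT Tc TD]] := fvs_toward (n := \max_(x : G) dist a x) conG ba bD fS.
    by move=> x _; apply: leq_trans (leq_bigmax x) (leq_addl _ _).
  have [U [TU conU Uc]] := connected_join conG TD.
  have := cfvs_le conG (conj (is_fvs_sub fT TU) conU); nia.
by have := cfvs_le_fvs1 conG f1; rewrite f1; lia.
Qed.

(** * Feedback vertex sets of butterflies *)

Section ButterflyCfvs.
Variables i j k : nat.
Hypotheses (i2 : 2 < i) (j2 : 2 < j) (k1 : 1 < k).
Let B := butterfly i j k.

Lemma butterfly_connected : connected B.
Proof.
have i0 : 0 < i by lia.
have k0 : 0 < k.-1 by lia.
(* Labels increase along the first cycle, then the path, then the second cycle. *)
pose f (u : B) := match u with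
  | inl (inl e) => val e | inl (inr e) => i + k + e | inr s => i + s end.
apply: (@connected_rooted B (inl (inl (Ordinal i0))) f) => -[[e|e]|s] ne.
- case: e ne => -[|e] ei ne; first by case: ne; congr (inl (inl _)); apply: val_inj.
  exists (inl (inl (Ordinal (ltnW ei)))) => //=.
  by rewrite butterfly_edgeE // /cyclic_adj /= eqxx.
- case: e ne => -[|e] ej ne; last first.
    exists (inl (inr (Ordinal (ltnW ej)))) => /=; last lia.
    by rewrite butterfly_edgeE // /cyclic_adj /= eqxx.
  have kl : k.-2 < k.-1 by lia.
  exists (inr (Ordinal kl)) => /=; last lia.
  by rewrite butterfly_edgeE //=; lia.
case: s ne => -[|s] sk ne.
  exists (inl (inl (Ordinal i0))) => /=; last lia.
  by rewrite butterfly_edgeE.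
exists (inr (Ordinal (ltnW sk))) => /=; last lia.
by rewrite butterfly_edgeE //= eqxx.
Qed.

Lemma butterfly_left_cycle : cycle_fun i
  (fun s => inl (inl (insubd (Ordinal (ltn_trans (isT : 0 < 2) i2)) s)) : B).
Proof.
split=> //.
- by move=> s si; rewrite /= butterfly_edgeE // /cyclic_adj !val_insubd si (ltnW si) eqxx.
- rewrite /= butterfly_edgeE // /cyclic_adj !val_insubd.
  by case: ifP; case: ifP; lia.
by move=> s t si ti [/(congr1 val)]; rewrite !val_insubd si ti.
Qed.

Lemma butterfly_right_cycle : cycle_fun j
  (fun s => inl (inr (insubd (Ordinal (ltn_trans (isT : 0 < 2) j2)) s)) : B).
Proof.
split=> //.
- by move=> s si; rewrite /= butterfly_edgeE // /cyclic_adj !val_insubd si (ltnW si) eqxx.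
- rewrite /= butterfly_edgeE // /cyclic_adj !val_insubd.
  by case: ifP; case: ifP; lia.
by move=> s t si ti [/(congr1 val)]; rewrite !val_insubd si ti.
Qed.

Lemma butterfly_fvs_gt0 : 0 < fvs B.
Proof.
have [S /is_fvsP fS <-] := fvs_witness B.
have [s _ sS] := fS _ _ butterfly_left_cycle.
by apply/card_gt0P; exists (inl (inl (insubd (Ordinal (ltn_trans (isT : 0 < 2) i2)) s))).
Qed.

(* Of a vertex of a cycle with the largest label, both neighbours on the cycle
   have the same label. *)
Lemma cycle_not_in_path (G : sgraph) n (c : nat -> G) (l : G -> nat) :
  cycle_fun n c ->
  (forall s t, s < n -> t < n -> l (c s) = l (c t) -> c s = c t) ->
  (forall s t, s < n -> t < n -> edge (c s) (c t) ->
     l (c t) = (l (c s)).+1 \/ l (c s) = (l (c t)).+1) -> False.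
Proof.
move=> cc linj ledge; have n0 : 0 < n by have := cyc_size cc; lia.
have [h _ hmax] := arg_maxnP (P := predT) (fun h : 'I_n => l (c h)) (erefl : predT (Ordinal n0)).
have [c' [cc' c'0 c'c]] := cycle_rot cc (ltn_ord h).
have {}hmax s : s < n -> l (c' s) <= l (c' 0).
  by move=> /c'c[t tn ->]; rewrite c'0; apply: (hmax (Ordinal tn)).
have down s : s < n -> edge (c' 0) (c' s) -> l (c' 0) = (l (c' s)).+1.
  move=> sn; have := hmax s sn; have [t tn ->] := c'c s sn.
  rewrite c'0 => le /(ledge _ _ (ltn_ord h) tn); lia.
have [n2 st cl inj] := cc'.
have E1 := down 1 (ltnW n2) (st 0 (ltnW n2)).
have n1 : n.-1 < n by lia.
have E2 : l (c' 0) = (l (c' n.-1)).+1 by apply: down; rewrite // edge_sym.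
have : c' 1 = c' n.-1.
  have [t tn tE] := c'c 1 (ltnW n2); have [t' t'n t'E] := c'c _ n1.
  by rewrite tE t'E; apply: linj => //; rewrite -tE -t'E; lia.
by move/inj; lia.
Qed.

(** Deleting both cycles leaves a path. The bound is crude, but independent of [k]. *)
Lemma butterfly_fvs_le : fvs B <= i + j.
Proof.
have -> : i + j = #|[set inl u | u : ('I_i + 'I_j)%type] : {set B}|.
  by rewrite card_imset ?card_sum ?card_ord //; move=> ? ? [].
apply/fvs_le/is_fvsP => n c cc; apply: contrapT => H.
have inner s : s < n -> exists t, c s = inr t.
  move=> sn; case E : (c s) => [u|t]; last by exists t.
  by case: H; exists s => //; rewrite E; apply: imset_f.
apply: (cycle_not_in_path (l := fun u : B => if u is inr s then val s else 0) cc).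
  move=> s t /inner[s' ->] /inner[t' ->] /= E; congr inr; exact: val_inj.
move=> s t /inner[s' ->] /inner[t' ->] /=; rewrite butterfly_edgeE //=; lia.
Qed.

(** If an inner path vertex [p] is missed, the part of [S] to its left is closed under adjacency,
    although [S] meets both cycles. *)
Lemma butterfly_cfvs_ge : k.-1 <= cfvs B.
Proof.
have [S [/is_fvsP fS conS] <-] := cfvs_witness butterfly_connected.
have [s _ sS] := fS _ _ butterfly_left_cycle.
have [t _ tS] := fS _ _ butterfly_right_cycle.
have -> : k.-1 = #|[set inr p | p : 'I_k.-1] : {set B}|.
  by rewrite card_imset ?card_ord //; move=> ? ? [].
apply/subset_leq_card/subsetP => _ /imsetP[p _ ->]; apply: contrapT => /negP pS.
pose left (x : induced S) := match val x with
  | inl (inl _) => true | inl (inr _) => false | inr q => q < p end.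
have cl : fingraph.closed (@edge (induced S)) left.
  move=> [x xS] [y yS] /=; rewrite /induced_edge /= butterfly_edgeE // !unfold_in /left /=.
  have neq (q : 'I_k.-1) : inr q \in S -> q <> p :> nat.
    by move=> qS /val_inj E; rewrite -E qS in pS.
  have pk := ltn_ord p.
  case: x xS => [[e|e]|q] xS; case: y yS => [[e'|e']|q'] yS //=.
  - by case: ifP => //=; case: ifP; lia.
  - by case: eqP => //=; have := neq _ yS; lia.
  - by case: ifP => //=; case: ifP; lia.
  - by case: eqP => //=; have := neq _ yS; have := ltn_ord q'; lia.
  - by case: eqP => //=; have := neq _ xS; lia.
  - by case: eqP => //=; have := neq _ xS; have := ltn_ord q; lia.
  by have := neq _ xS; have := neq _ yS; lia.
by have := closed_connect cl (conS (exist (fun u => u \in S) _ sS) (exist (fun u => u \in S) _ tS)).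
Qed.

End ButterflyCfvs.

Lemma not_covers_butterfly_free (I : finType) (F : I -> sgraph) i j k :
  2 < i -> 2 < j -> ~ covers F i j -> covering_length F <= k ->
  free_of F (butterfly i j k).
Proof.
move=> i2 j2 nc Nk h Hh; apply: nc; exists h.
apply: butterfly_shrink Hh => //; have := leq_bigmax (F := fun h => #|F h|) h.
by rewrite /covering_length; lia.
Qed.

Local Open Scope ring_scope.

(* MathComp world. For a tree, [cfvs G] and [fvs G] are both 0, and the
   quotient 0 / 0 is 0. *)
Theorem theorem1 (R : realType) (I : finType) (F : I -> sgraph) :
  (exists c : R, forall G : sgraph, connected G -> free_of F G ->
     (cfvs G)%:R / (fvs G)%:R <= c)
  <->
  (forall i j : nat, (3 <= i)%N -> (3 <= j)%N -> covers F i j).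
Proof.
split=> [[c cP] i j i2 j2|cov].
  apply: contrapT => nc; pose n := Num.bound `|c|.
  (* Long enough for the butterfly to be free of the family, and for [k.-1] to be at least
     [n * fvs], where [n] exceeds [c]. *)
  pose k := (covering_length F + (i + j) * n + 2)%N.
  have k1 : (1 < k)%N by rewrite /k; lia.
  have := cP _ (butterfly_connected i2 j2 k1)
    (not_covers_butterfly_free i2 j2 nc (k := k) ltac:(rewrite /k; lia)).
  rewrite ler_pdivrMr ?ltr0n ?butterfly_fvs_gt0 // leNgt => /negP; apply.
  have cn : c < n%:R.
    by apply: le_lt_trans (ler_norm c) _; apply: archi_boundP.
  apply: lt_le_trans (_ : n%:R * (fvs (butterfly i j k))%:R <= _).
    by rewrite ltr_pM2r ?ltr0n ?butterfly_fvs_gt0.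
  rewrite -natrM ler_nat; apply: leq_trans (butterfly_cfvs_ge i2 j2 k1).
  by have := @butterfly_fvs_le i j k i2 j2; rewrite /k; nia.
exists (branching_bound F + 2)%:R => G conG free.
case: (posnP (fvs G)) => [->|f0]; first by rewrite invr0 mulr0 ler0n.
by rewrite ler_pdivrMr ?ltr0n // -natrM ler_nat covers_cfvs_bounded.
Qed.
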